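(* For any compact ENR $X$, $$\mathrm{cat}((X\times X)/\Delta X)\le TC^M(X)\le \infty\text{-}\mathrm{cat}((X\times X)\setminus\Delta X),$$ where $\Delta X\subset X\times X$ is the diagonal.
   Context: ENR means Euclidean neighborhood retract. $\mathrm{cat}(Y)$ is the (non-reduced) Lusternik-Schnirelmann category: the minimal number $k$ such that $Y$ can be covered by $k$ open sets each contractible to a point in $Y$. $PX=X^{[0,1]}$ is the space of all paths in $X$ and $\pi:PX\to X\times X$ is the fibration $\pi(f)=(f(0),f(1))$. A section $s$ of $\pi$ over $U\subset X\times X$ is called reserved if $s(x,x)$ is the constant path at $x$ for every $(x,x)\in U$. $TC^M(X)$ (monoidal topological complexity) is the minimal $k$ such that $X\times X$ admits an open cover $U_1,\dots,U_k$ with continuous reserved sections $s_i:U_i\to PX$ of $\pi$. A subset $A\subset Y$ can be $rel\ \infty$ contracted to infinity if for every compact subset $F\subset Y$ there is a larger compact set $C\supset F$ and a homotopy $h_t:A\to Y$, $t\in[0,1]$, with $h_0$ the inclusion of $A$, $h_1(A)\cap F=\emptyset$ and $h_t(a)=a$ for all $t$ and all $a\in A\setminus C$. For a locally compact space $Y$, $\infty\text{-}\mathrm{cat}(Y)$ is the minimal $k$ such that there is a cover $Y=V_1\cup\dots\cup V_k$ by closed subsets each of which can be $rel\ \infty$ contracted to infinity. *)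

(* Defs.v *)
From HB Require Import structures.
From mathcomp Require Import all_boot all_order all_algebra generic_quotient.
From mathcomp Require Import all_classical all_reals all_analysis.

Set Implicit Arguments.
Unset Strict Implicit.
Unset Printing Implicit Defensive.

Import Order.TTheory GRing.Theory Num.Theory.
Import numFieldNormedType.Exports.

Local Open Scope classical_set_scope.
Local Open Scope ring_scope.

(* The interval [0, 1] as a space in its own right.  With [subspace `[0, 1]]
   instead, the points outside [0, 1] would remain as isolated points and would
   be seen by the compact-open topology. *)
Definition unit_interval (R : realType) : Type := set_type `[0 : R, 1]%classic.

HB.instance Definition _ (R : realType) :=
  Topological.copy (unit_interval R) (set_type `[0 : R, 1]%classic).

Section unit_interval_endpoints.
Context {R : realType}.

Lemma mem_unit_interval0 : (0 : R) \in `[0 : R, 1]%classic.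
Proof. by rewrite inE /= in_itv /= lexx ler01. Qed.

Lemma mem_unit_interval1 : (1 : R) \in `[0 : R, 1]%classic.
Proof. by rewrite inE /= in_itv /= lexx ler01. Qed.

Definition I0 : unit_interval R := exist _ 0 mem_unit_interval0.
Definition I1 : unit_interval R := exist _ 1 mem_unit_interval1.

Lemma I0_neq_I1 : I0 != I1.
Proof.
by apply/eqP => /(congr1 (@proj1_sig _ _))/= /esym/eqP; rewrite oner_eq0.
Qed.

HB.instance Definition _ := isBiPointed.Build (unit_interval R) I0_neq_I1.

End unit_interval_endpoints.

(* P X = X^[0, 1], with the compact-open topology. *)
Definition path_space (R : realType) (X : topologicalType) : Type :=
  continuousType (unit_interval R) X.

HB.instance Definition _ (R : realType) (X : topologicalType) :=
  Topological.copy (path_space R X)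
    (initial_topology (fun p : continuousType (unit_interval R) X =>
       (p : unit_interval R -> X) : {compact-open, unit_interval R -> X})).

Definition path_ends (R : realType) (X : topologicalType)
    (p : path_space R X) : X * X :=
  let f : unit_interval R -> X := p in (f zero, f one).

Definition homeomorphic (X Y : topologicalType) : Prop :=
  exists (f : X -> Y) (g : Y -> X),
    [/\ continuous f, continuous g, cancel f g & cancel g f].

Definition is_retract_of (T : topologicalType) (Z O : set T) : Prop :=
  Z `<=` O /\ exists r : T -> T,
    [/\ {within O, continuous r}, r @` O `<=` Z & forall z, Z z -> r z = z].

Definition is_ENR (R : realType) (X : topologicalType) : Prop :=
  exists (n : nat) (Z : set 'rV[R]_n),
    homeomorphic X (set_type Z) /\
    exists2 O : set 'rV[R]_n, open O & is_retract_of Z O.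

Section collapse.
Local Open Scope quotient_scope.
Context {T : topologicalType} (A : set T).

Let collapse_rel' (x y : T) := (x == y) || ((x \in A) && (y \in A)).

Local Lemma collapse_rel_refl : reflexive collapse_rel'.
Proof. by move=> x; rewrite /collapse_rel' eqxx. Qed.

Local Lemma collapse_rel_sym : symmetric collapse_rel'.
Proof. by move=> x y; rewrite /collapse_rel' eq_sym andbC. Qed.

Local Lemma collapse_rel_trans : transitive collapse_rel'.
Proof.
move=> y x z /predU1P[->//|/andP[xA yA]] /predU1P[<-|/andP[_ zA]];
by rewrite /collapse_rel' xA ?yA ?zA orbT.
Qed.

Definition collapse_rel :=
  EquivRel collapse_rel' collapse_rel_refl collapse_rel_sym collapse_rel_trans.

(* T / A; if A is empty, this is T itself. *)
Definition collapse := {eq_quot collapse_rel}.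

HB.instance Definition _ :=
  Topological.copy collapse (quotient_topology collapse).
HB.instance Definition _ := Quotient.on collapse.

End collapse.

Arguments collapse {T} A.

(* The least k >= 1 such that P k, or +oo if there is none.  Covers have at
   least one member: with k = 0 allowed, the empty space would be covered by no
   sets, and for X a point one would get TC^M(X) = 1 and
   oo-cat((X x X) \ Delta X) = 0. *)
Definition minimal_number (R : realType) (P : nat -> Prop) : \bar R :=
  ereal_inf [set k%:R%:E | k in [set k : nat | (0 < k)%N /\ P k]].

Lemma minimal_number_attained (R : realType) (P : nat -> Prop) (n : nat) :
  minimal_number R P = n%:R%:E <->
  [/\ (0 < n)%N, P n & forall k, (0 < k)%N -> P k -> (n <= k)%N].
Proof.
have key m : (0 < m)%N -> P m ->
    (forall k, (0 < k)%N -> P k -> (m <= k)%N) ->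
    minimal_number R P = m%:R%:E.
  move=> m0 Pm mmin; apply/eqP; rewrite eq_le; apply/andP; split.
    by apply: ereal_inf_lbound; exists m.
  apply: le_ereal_inf_tmp => _ [k [k0 Pk] <-].
  by rewrite lee_fin ler_nat; exact: mmin.
split=> [Hn|[]]; last exact: key.
have [[m [m0 Pm]]|nP] := pselect (exists m, (0 < m)%N /\ P m); last first.
  suff Q0 : [set k | (0 < k)%N /\ P k] = set0.
    by move: Hn; rewrite /minimal_number Q0 image_set0 ereal_inf0.
  by rewrite -subset0 => k kP; apply: nP; exists k.
have exQ : exists m, (0 < m)%N && `[< P m >].
  by exists m; rewrite m0; apply/asboolP.
case: (ex_minnP exQ) => l /andP[l0 /asboolP Pl] lmin.
have lmin' k : (0 < k)%N -> P k -> (l <= k)%N.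
  by move=> k0 Pk; apply: lmin; rewrite k0; apply/asboolP.
by move: Hn; rewrite (key l)// => -[/eqP]; rewrite eqr_nat => /eqP <-.
Qed.

(* The final map h_1 is required to be constant on U.  For U nonempty this says
   that h_1(U) is a point of Y; the empty set is contractible, also when Y itself
   is empty. *)
Definition contractible_in (R : realType) (Y : topologicalType) (U : set Y) :
    Prop :=
  exists h : Y * unit_interval R -> Y,
    [/\ {within U `*` setT, continuous h},
        forall y, U y -> h (y, zero) = y &
        forall y z, U y -> U z -> h (y, one) = h (z, one)].

(* Non-reduced Lusternik-Schnirelmann category. *)
Definition LS_cat (R : realType) (Y : topologicalType) : \bar R :=
  minimal_number R (fun k => exists U : 'I_k -> set Y,
    [/\ forall i, open (U i), \bigcup_i U i = setT &
        forall i, contractible_in R (U i)]).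

Definition reserved_section (R : realType) (X : topologicalType)
    (U : set (X * X)) (s : X * X -> path_space R X) : Prop :=
  [/\ {within U, continuous s},
      forall z, U z -> path_ends (s z) = z &
      forall x, U (x, x) -> (s (x, x) : unit_interval R -> X) = cst x].

(* Monoidal topological complexity TC^M. *)
Definition monoidal_TC (R : realType) (X : topologicalType) : \bar R :=
  minimal_number R (fun k => exists U : 'I_k -> set (X * X),
    [/\ forall i, open (U i), \bigcup_i U i = setT &
        forall i, exists s : X * X -> path_space R X,
          reserved_section (U i) s]).

Definition rel_infty_contractible (R : realType) (Y : topologicalType)
    (A : set Y) : Prop :=
  forall F : set Y, compact F ->
    exists C : set Y, [/\ compact C, F `<=` C &
      exists h : Y * unit_interval R -> Y,
        [/\ {within A `*` setT, continuous h},
            forall a, A a -> h (a, zero) = a,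
            forall a, A a -> ~ F (h (a, one)) &
            forall a t, A a -> ~ C a -> h (a, t) = a]].

Definition infty_cat (R : realType) (Y : topologicalType) : \bar R :=
  minimal_number R (fun k => exists V : 'I_k -> set Y,
    [/\ forall i, closed (V i), \bigcup_i V i = setT &
        forall i, rel_infty_contractible R (V i)]).

(* Main.v *)
Require Import Defs.
From HB Require Import structures.
From mathcomp Require Import all_boot all_order all_algebra.
From mathcomp Require Import all_classical all_reals all_analysis.
From mathcomp Require Import lra.

Set Implicit Arguments.
Unset Strict Implicit.
Unset Printing Implicit Defensive.

Import Order.TTheory GRing.Theory Num.Theory.
Import numFieldNormedType.Exports.
Local Open Scope classical_set_scope.
Local Open Scope ring_scope.

(** Why the inequalities hold.  A compact ENR X is an absolute neighbourhood
    extensor for compact Hausdorff spaces (Tietze in each coordinate, followed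
    by the retraction): see [ENR_neighborhood_extension].  A path from x to y
    that depends continuously on (x, y) in a set A is a map A x [0, 1] -> X with
    prescribed values on A x {0, 1}.  If A is closed and contains the diagonal,
    this map extends to a neighbourhood of
    A x [0, 1] U (X x X) x {0, 1}, hence, [0, 1] being compact, to G x [0, 1]
    for an open G that contains A.  This is [reserved_section_extension]:
    reserved sections only have to be built over closed sets containing the
    diagonal, and in return they are obtained over open sets containing it.

    First inequality.  Shrink an open cover U_i with reserved sections s_i to a
    closed cover F_i.  Since s_i is constant on diagonal points, it glues over
    F_i with the constant paths over the whole diagonal, and extends to an open
    G_i containing F_i and the diagonal.  Following s_i(x, y) in the first
    coordinate while y stays fixed moves (x, y) to (y, y) and keeps the diagonal
    pointwise fixed, so it induces a contraction of the open image of G_i in the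
    quotient (X x X) / Delta X onto the point of the diagonal
    ([contractible_collapse]).

    Second inequality.  Let W be the open set of the (x, y) such that the
    segment between x and y in the ambient Euclidean space remains in the domain
    of the retraction; W contains the diagonal, and its complement F is a
    compact subset of the complement Y of the diagonal.  If V, closed in Y, is deformed
    out of F by h, then (x, y) in V is joined to a point (x', y') of W.  Follow
    the first coordinate of h from x to x', then the retracted segment from x'
    to y', then the second coordinate of h backwards from y' to y.  Near the
    diagonal h is stationary, so this path is the retracted segment and tends to
    a constant path: the section is continuous and reserved over the union of V
    with the diagonal, which is closed
    ([reserved_section_rel_infty]). *)

(** * Hausdorff spaces, subspaces and the tube lemma *)

Lemma hausdorff_separated (S : topologicalType) :
  (forall x y : S, x <> y -> exists (T : topologicalType) (f : S -> T),
     [/\ hausdorff_space T, continuous f & f x <> f y]) ->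
  hausdorff_space S.
Proof.
move=> sep x y clxy; apply: contrapT => /sep[T [f [hT cf]]]; apply.
apply: hT => A B /cf fA /cf fB.
by have [z [Az Bz]] := clxy _ _ fA fB; exists (f z).
Qed.

Lemma hausdorff_prod (S T : topologicalType) :
  hausdorff_space S -> hausdorff_space T -> hausdorff_space (S * T)%type.
Proof.
move=> hS hT; apply: hausdorff_separated => -[x1 x2] [y1 y2] neq.
have [eq1|neq1] := pselect (x1 = y1).
  exists T, snd; split=> // [p|/= eq2]; first exact: cvg_snd.
  by apply: neq; rewrite eq1 eq2.
by exists S, fst; split=> // p; exact: cvg_fst.
Qed.

Lemma hausdorff_set_type (T : topologicalType) (A : set T) :
  hausdorff_space T -> hausdorff_space (set_type A).
Proof.
move=> hT; apply: hausdorff_separated => x y neq; exists T, set_val.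
by split=> // [|/val_inj//]; exact: initial_continuous.
Qed.

Lemma nbhs_set_typeP (T : topologicalType) (A : set T) (a : set_type A)
    (W : set (set_type A)) :
  nbhs a W <-> exists2 U, nbhs (set_val a) U & set_val @^-1` U `<=` W.
Proof.
split=> [[_ [[U oU <-] Ua UW]]|[U Ua UW]].
  by exists U => //; exact: open_nbhs_nbhs.
by apply: filterS UW _; exact: initial_continuous.
Qed.

Lemma compact_set_type (T : topologicalType) (A : set T)
    (B : set (set_type A)) :
  compact (set_val @` B) -> compact B.
Proof.
move=> /compact_near_coveringP cB; apply/compact_near_coveringP.
move=> I F P FF PB.
apply: filterS (cB I F (fun i x => forall a, set_val a = x -> P i a) FF _).
  by move=> i Pi b Bb; apply: (Pi (set_val b)) => //; exists b.
move=> _ [b Bb <-].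
have [[U V] [/nbhs_set_typeP[U' U'b U'U] FV] UVP] := PB b Bb.
exists (U', V) => // -[x i] [/= U'x Vi] a ax.
by apply: (UVP (a, i)); split=> //=; apply: U'U; rewrite /preimage /= ax.
Qed.

(** The compact factor lets one neighbourhood of z serve for all t at once. *)
Lemma open_tube (Z T : topologicalType) (O : set (Z * T)) :
  compact [set: T] -> open O -> open [set z | forall t, O (z, t)].
Proof.
move=> /compact_near_coveringP cT oO; rewrite openE => z /= Oz.
apply: filterS (cT Z (nbhs z) (fun z' t => O (z', t)) _ _).
  by move=> z' + t; exact.
move=> t _; have [[U V] [/= Uz Vt] UVO] : nbhs (z, t) O.
  by apply: open_nbhs_nbhs; split=> //; exact: Oz.
by exists (V, U) => // -[t' z'] [Vt' Uz']; exact: (UVO (z', t')).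
Qed.

(** * The unit interval and path spaces *)

Lemma unit_interval_compact (R : realType) : compact [set: unit_interval R].
Proof.
apply: compact_set_type; rewrite (_ : _ @` _ = `[0 : R, 1]%classic).
  exact: segment_compact.
apply/seteqP; split=> [_ [a _ <-]|x x01]; first exact: set_valP.
by exists (exist _ x (mem_set x01)).
Qed.

Lemma unit_interval_hausdorff (R : realType) :
  hausdorff_space (unit_interval R).
Proof. by apply: hausdorff_set_type; exact: Rhausdorff. Qed.

Lemma unit_interval_locally_compact (R : realType) :
  locally_compact [set: unit_interval R].
Proof.
move=> t _; rewrite withinET; exists setT; first exact: filterT.
by split; [exact: unit_interval_compact|exact: closedT].
Qed.

Section path_space.
Context {R : realType} {X Z : topologicalType}.

Lemma path_space_eval_continuous :
  continuous (fun p : path_space R X * unit_interval R =>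
    (p.1 : unit_interval R -> X) p.2).
Proof.
pose f (s : path_space R X) : unit_interval R -> X := s.
rewrite (_ : (fun p => _) = uncurry f); last by apply/funext => -[].
apply: continuous_uncurry.
- exact: unit_interval_locally_compact.
- exact: unit_interval_hausdorff.
- exact: initial_continuous.
- by move=> s; exact: cts_fun.
Qed.

Lemma path_space_uncurry (A : set Z) (s : Z -> path_space R X) :
  {within A, continuous s} ->
  {within A `*` setT, continuous (fun p : Z * unit_interval R =>
     (s p.1 : unit_interval R -> X) p.2)}.
Proof.
move=> /subspace_continuousP cs; apply/subspace_continuousP => -[z t] [/= Az _].
have cfst : fst @ within (A `*` setT) (nbhs (z, t)) --> within A (nbhs z).
  move=> U zU; have UF : nbhs (z, t) [set p | A p.1 -> U p.1] by
    exact: (@cvg_fst _ _ (nbhs z) (nbhs t) _ [set z' | A z' -> U z'] zU).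
  by apply: filterS UF => p Up [/= Ap _]; exact: Up.
have csnd : snd @ within (A `*` setT) (nbhs (z, t)) --> t.
  move=> U tU; have UF : nbhs (z, t) (snd @^-1` U).
    exact: (@cvg_snd _ _ (nbhs z) (nbhs t) _ U tU).
  by apply: filterS UF => p Up _.
have cst : (s p.1, p.2) @[p --> within (A `*` setT) (nbhs (z, t))] --> (s z, t).
  apply: (@cvg_pair _ _ _ _ (nbhs (s z)) (nbhs t)) => //.
  exact: (cvg_comp _ _ cfst (cs z Az)).
pose g (p : Z * unit_interval R) := (s p.1, p.2).
pose h (p : path_space R X * unit_interval R) :=
  (p.1 : unit_interval R -> X) p.2.
have cst' : g @ within (A `*` setT) (nbhs (z, t)) --> g (z, t) by [].
have ch : h @ nbhs (g (z, t)) --> h (g (z, t)).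
  exact: path_space_eval_continuous.
exact: (cvg_comp g h cst' ch).
Qed.

(** A continuous family of paths parametrised by [A] becomes a map to the path
    space.  That map has to be total, and [d] supplies constant paths outside
    [A], where the subspace topology is discrete. *)
Lemma path_space_curry (A : set Z) (f : Z * unit_interval R -> X) (d : Z -> X) :
  {within A `*` setT, continuous f} ->
  exists s : Z -> path_space R X, {within A, continuous s} /\
    forall z, A z -> forall t, (s z : unit_interval R -> X) t = f (z, t).
Proof.
move=> /subspace_continuousP cf.
pose g (p : subspace A * unit_interval R) := if p.1 \in A then f p else d p.1.
have cg : continuous g.
  move=> [z t]; have [Az|nAz] := pselect (A z).
    rewrite /continuous_at {2}/g /= mem_set// => W /(cf (z, t)).
    case=> // -[U V] [/= Uz Vt] UVW; exists (U `&` A, V) => /=.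
      split=> //; rewrite -[nbhs _]nbhs_subspace_in//.
      by rewrite /within /=; near=> z' => Az'; split=> //; near: z'.
    by move=> [z' t'] [[/= Uz' Az'] Vt']; rewrite /g /= mem_set//; exact: UVW.
  rewrite /continuous_at {2}/g /= memNset// => W /nbhs_singleton Wd.
  exists ([set z], setT) => /=.
    by split; [rewrite -[nbhs _]nbhs_subspace_out|exact: filterT].
  by move=> [_ t'] [/= -> _]; rewrite /g /= memNset.
have [ccg cgz] := continuous_curry cg.
exists (fun z => mkcts (cgz z)); split.
  apply: continuous_comp_initial; exact: ccg.
by move=> z Az t; rewrite -[LHS]/(g (z, t)) /g /= mem_set.
Unshelve. all: by end_near. Qed.
End path_space.

(** * Compact ENRs as neighbourhood extensors *)

Lemma cvg_rV (R : realType) n T (F : set_system T) (FF : Filter F)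
    (f : T -> 'rV[R]_n) (v : 'rV[R]_n) :
  (forall j, f x ord0 j @[x --> F] --> v ord0 j) -> f @ F --> v.
Proof.
move=> fv W [P Pv PW].
suff FP : F [set x | forall j, P ord0 j (f x ord0 j)].
  rewrite /fmap/=; apply: (@filterS _ F _ _ _ _ FP) => x Px; apply: PW => i j.
  by rewrite ord1; exact: Px.
by apply: filter_forall => j; exact: (fv j _ (Pv ord0 j)).
Qed.

Lemma rV_hausdorff (R : realType) n : hausdorff_space 'rV[R]_n.
Proof.
apply: hausdorff_separated => v w neq.
have [j vwj] : exists j, v ord0 j <> w ord0 j.
  apply: contrapT => /forallNP vw; apply: neq; apply/rowP => j.
  exact: contrapT (vw j).
exists R, (fun u : 'rV[R]_n => u ord0 j); split=> //.
exact: coord_continuous.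
Qed.

(** The Tietze theorem for scalar functions requires a bound, which holds here
    because a closed subset of a compact space has a compact image. *)
Lemma tietze_rV (R : realType) (T : topologicalType) n (A : set T)
    (f : T -> 'rV[R]_n) :
  hausdorff_space T -> compact [set: T] -> closed A ->
  {within A, continuous f} ->
  exists g : T -> 'rV[R]_n, continuous g /\ forall x, A x -> g x = f x.
Proof.
move=> hT cT clA cf.
have cA : compact A by exact: subclosed_compact cT _.
have ext j : exists g : T -> R,
    continuous g /\ forall x, A x -> g x = f x ord0 j.
  pose fj x : R^o := f x ord0 j.
  have cfj : {within A, continuous fj}.
    pose coord (v : 'rV[R]_n) := v ord0 j.
    move=> x; apply: (@continuous_comp (subspace A) _ _ f coord).
      exact: cf.
    exact: coord_continuous.
  have /(@compact_bounded _ R^o)/pinfty_ex_gt0[M M0 fM] :=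
    continuous_compact cfj cA.
  have [|g [fg cg _]] :=
      continuous_bounded_extension (compact_normal hT cT) clA M0 cfj.
    by move=> x Ax; apply: fM; exists x.
  by exists g; split=> // x Ax; rewrite -fg// mem_set.
have [g gP] := choice ext.
exists (fun x => \row_j g j x); split=> [x|x Ax].
  apply: cvg_rV => j; under eq_fun do rewrite mxE.
  by rewrite mxE; exact: (gP j).1.
by apply/rowP => j; rewrite mxE (gP j).2.
Qed.

(** An embedding [e] in a Euclidean space, with a map [r] that takes the points
    of an open neighbourhood of the image back to [X].  The point [x0]
    gives [r] a value outside this neighbourhood. *)
Lemma ENR_retract (R : realType) (X : topologicalType) (x0 : X) :
  is_ENR R X -> exists (n : nat) (O : set 'rV[R]_n) (e : X -> 'rV[R]_n)
    (r : 'rV[R]_n -> X),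
    [/\ open O, continuous e, forall v, O v -> {for v, continuous r},
        forall x, O (e x) & cancel e r].
Proof.
move=> [n [Z [[f [g [cf cg fK gK]]] [U oU [ZU [r [cr rU rZ]]]]]]].
pose q v : set_type Z := insubd (f x0) (r v).
have qE v : U v -> set_val (q v) = r v.
  move=> Uv; rewrite -[LHS]/(\val (q v)) insubdK//.
  by apply: mem_set; apply: rU; exists v.
exists n, U, (set_val \o f), (g \o q); split=> //.
- by move=> x; apply: continuous_comp; [exact: cf|exact: initial_continuous].
- suff : {within U, continuous (g \o q)}.
    by rewrite continuous_open_subspace// => + v Uv; apply; rewrite inE.
  move=> v; apply: (@continuous_comp (subspace U) _ _ q g); last exact: cg.
  move: v; apply: continuous_comp_initial.
  by apply: subspace_eq_continuous cr => v /set_mem Uv /=; rewrite qE.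
- by move=> x; apply: ZU; exact: set_valP.
- move=> x /=; rewrite -[RHS]fK; congr g; apply: val_inj.
  have Zfx : Z (set_val (f x)) by exact: set_valP.
  by rewrite -[LHS]/(set_val (q _)) qE; [exact: rZ|exact: ZU].
Qed.

(** Extend the composite with the embedding to the whole of [T], and retract
    where the values fall in the domain of the retraction. *)
Lemma ENR_neighborhood_extension (R : realType) (X T : topologicalType)
    (A : set T) (f : T -> X) :
  is_ENR R X -> hausdorff_space T -> compact [set: T] -> closed A ->
  {within A, continuous f} ->
  exists (O : set T) (g : T -> X), [/\ open O, A `<=` O,
    {within O, continuous g} & forall x, A x -> g x = f x].
Proof.
move=> ENR_X hT cT clA cf.
have [[x0 _]|noT] := pselect ([set: T] !=set0); last first.
  by exists setT, f; split=> //; [exact: openT|move=> x; case: noT; exists x].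
have [n [U [e [r [oU ce cr Ue eK]]]]] := ENR_retract (f x0) ENR_X.
have cef : {within A, continuous (e \o f)}.
  move=> x; apply: (@continuous_comp (subspace A) _ _ f e); first exact: cf.
  exact: ce.
have [g [cg gE]] := tietze_rV hT cT clA cef.
exists (g @^-1` U), (r \o g); split.
- by apply: open_comp => // x _; exact: cg.
- by move=> x Ax /=; rewrite gE//; exact: Ue.
- apply: continuous_in_subspaceT => x; rewrite inE => Ugx.
  by apply: continuous_comp; [exact: cg|exact: cr].
- by move=> x Ax /=; rewrite gE//= eK.
Qed.

(** * Extending reserved sections to open sets *)

Lemma ENR_hausdorff (R : realType) (X : topologicalType) :
  is_ENR R X -> hausdorff_space X.
Proof.
move=> [n [Z [[f [g [cf _ fK _]]] _]]].
apply: hausdorff_separated => x y neq; exists (set_type Z), f; split=> //.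
  by apply: hausdorff_set_type; exact: rV_hausdorff.
by move=> /(can_inj fK).
Qed.

Lemma diagonal_closed (X : topologicalType) :
  hausdorff_space X -> closed (@diagonal X).
Proof.
move=> hX [x y] clxy; apply: hX => A B xA yB.
have [[a b] [/diagonalP-> [Ab Bb]]] : @diagonal X `&` (A `*` B) !=set0.
  by apply: clxy; exists (A, B).
by exists b.
Qed.

(** Each point has a neighbourhood whose closure lies in one of the [U i];
    finitely many of these closures cover, and [F i] collects those assigned to
    [i]. *)
Lemma closed_shrinking (T : topologicalType) (I : Type) (U : I -> set T) :
  hausdorff_space T -> compact [set: T] -> (forall i, open (U i)) ->
  \bigcup_i U i = setT ->
  exists F : I -> set T,
    [/\ forall i, closed (F i), forall i, F i `<=` U i & \bigcup_i F i = setT].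
Proof.
move=> hT cT oU UT.
have ex (x : T) : exists iV : I * set T,
    nbhs x iV.2 /\ closure iV.2 `<=` U iV.1.
  have [i _ Uix] : (\bigcup_i U i) x by rewrite UT.
  have xT : nbhs x [set: T] by exact: filterT.
  have [V Vx VU] : filter_from (nbhs x) closure (U i).
    by apply: (compact_regular hT cT xT); exact: open_nbhs_nbhs.
  by exists (i, V).
have [iV iVP] := choice ex.
(* The filter generated by the sequences containing a given one: compactness
   with respect to it yields a single sequence that covers. *)
pose G := filter_from [set: seq T]
  (fun D => [set D' : seq T | {subset D <= D'}]).
have fG : Filter G.
  apply: filter_from_filter; first by exists [::].
  move=> D1 D2 _ _; exists (D1 ++ D2) => // D /= sD.
  by split=> x xD; apply: sD; rewrite mem_cat xD ?orbT.
have [D TD] : exists D : seq T, forall y, exists2 x, x \in D & (iV x).2 y.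
  have [|D _ TD] := (compact_near_coveringP setT).1 cT (seq T) G
      (fun D y => exists2 x, x \in D & (iV x).2 y) fG; last first.
    by exists D => y; exact: TD.
  move=> x _; exists ((iV x).2, [set D | x \in D]).
    split; first exact: (iVP x).1.
    by exists [:: x] => // D /=; apply; rewrite mem_head.
  by move=> [y D] [/= xy xD]; exists x.
pose F i := \bigcup_(x in [set x | x \in D /\ (iV x).1 = i]) closure (iV x).2.
exists F; split=> [i|i y [x [_ <-] xy]|].
- apply: closed_bigcup => [|x _]; last exact: closed_closure.
  by apply: sub_finite_set (finite_seq D) => x [].
- exact: (iVP x).2.
- rewrite -subTset => y _; have [x Dx xy] := TD y.
  exists (iV x).1 => //; exists x => //.
  exact: subset_closure.
Qed.

Section reserved_sections.
Context {R : realType} {X : topologicalType}.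
Hypotheses (ENR_X : is_ENR R X) (compact_X : compact [set: X]).
Implicit Types (A F U : set (X * X)).

Let hX : hausdorff_space X := ENR_hausdorff ENR_X.

Lemma compact_square : compact [set: X * X].
Proof. by rewrite -setXTT; exact: compact_setX. Qed.

Let closed_setXT A : closed A -> closed (A `*` [set: unit_interval R]).
Proof.
move=> clA; rewrite (_ : _ `*` _ = fst @^-1` A).
  by apply: preimage_closed => // p _; exact: cvg_fst.
by apply/seteqP; split=> [p []|p /=].
Qed.

(** The paths over [A], extended by the endpoints over [(X * X) * {0, 1}], form
    a continuous map on a closed subset of [(X * X) * [0, 1]].  Extending that
    map keeps the endpoints of the new paths right over the whole open set. *)
Lemma reserved_section_extension A (f : (X * X) * unit_interval R -> X) :
  closed A -> @diagonal X `<=` A -> {within A `*` setT, continuous f} ->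
  (forall z, A z -> f (z, zero) = z.1 /\ f (z, one) = z.2) ->
  (forall x t, f ((x, x), t) = x) ->
  exists (U : set (X * X)) (s : X * X -> path_space R X),
    [/\ open U, A `<=` U & reserved_section U s].
Proof.
move=> clA dA cf fA fdiag.
pose g (p : (X * X) * unit_interval R) :=
  if p.2 == zero then p.1.1 else if p.2 == one then p.1.2 else f p.
pose B0 := setT `*` [set zero] : set ((X * X) * unit_interval R).
pose B1 := setT `*` [set one] : set ((X * X) * unit_interval R).
have cl0 (t : unit_interval R) :
    closed (setT `*` [set t] : set ((X * X) * unit_interval R)).
  rewrite (_ : _ `*` _ = snd @^-1` [set t]).
    apply: preimage_closed => [p _|]; first exact: cvg_snd.
    apply: accessible_closed_set1; apply: hausdorff_accessible.
    exact: unit_interval_hausdorff.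
  by apply/seteqP; split=> [p []|p /=].
have clB : closed (A `*` setT `|` (B0 `|` B1)).
  by apply: closedU; [exact: closed_setXT|apply: closedU; exact: cl0].
have cg : {within A `*` setT `|` (B0 `|` B1), continuous g}.
  apply: withinU_continuous.
  - exact: closed_setXT.
  - by apply: closedU; exact: cl0.
  - apply: subspace_eq_continuous cf => -[z t] /set_mem[/= Az _].
    have [f0 f1] := fA z Az; rewrite /from_subspace /g /=.
    have [->//|_] := eqVneq t zero.
    by have [->|_] := eqVneq t one.
  - apply: withinU_continuous; try exact: cl0.
      apply: (@subspace_eq_continuous _ B0 _ (fun p => p.1.1)).
        by move=> [z t] /set_mem[_ /= ->]; rewrite /from_subspace /g /= eqxx.
      apply: continuous_subspaceT => p.
      by apply: continuous_comp; exact: cvg_fst.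
    apply: (@subspace_eq_continuous _ B1 _ (fun p => p.1.2)).
      move=> [z t] /set_mem[_ /= ->]; rewrite /from_subspace /g /= eqxx.
      by rewrite eq_sym (negbTE zero_one_neq).
    apply: continuous_subspaceT => p.
    by apply: continuous_comp; [exact: cvg_fst|exact: cvg_snd].
have hT : hausdorff_space ((X * X) * unit_interval R)%type.
  apply: hausdorff_prod (@unit_interval_hausdorff R).
  exact: hausdorff_prod.
have cT : compact [set: (X * X) * unit_interval R].
  rewrite -setXTT; apply: compact_setX; first exact: compact_square.
  exact: unit_interval_compact.
have [V [h [oV BV ch hg]]] := ENR_neighborhood_extension ENR_X hT cT clB cg.
pose U := [set z | forall t, V (z, t)].
have [|s [cs sh]] := path_space_curry (A := U) (f := h) fst.
  by apply: continuous_subspaceW ch => -[z t] [/= Uz _]; exact: Uz.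
exists U, s; split.
- by apply: open_tube => //; exact: unit_interval_compact.
- by move=> z Az t; apply: BV; left.
have sg z t : A z -> (s z : unit_interval R -> X) t = g (z, t).
  move=> Az; rewrite sh ?hg//; first by left.
  by move=> t'; apply: BV; left.
split=> // [z Uz|x Uxx].
- rewrite /path_ends !sh//= !hg; [|by right; right|by right; left].
  rewrite /g /= !eqxx eq_sym (negbTE zero_one_neq).
  by case: z {Uz}.
- apply/funext => t; rewrite sg; last exact: dA.
  by rewrite /g /= fdiag !if_same.
Qed.

(** Over the points of [F] on the diagonal [s] is constant, so that it agrees
    there with the constant paths. *)
Lemma reserved_section_diagonal U F (s : X * X -> path_space R X) :
  reserved_section U s -> closed F -> F `<=` U ->
  exists (G : set (X * X)) (s' : X * X -> path_space R X),
    [/\ open G, F `|` @diagonal X `<=` G & reserved_section G s'].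
Proof.
move=> [cs ends_s refl_s] clF FU.
pose f (p : (X * X) * unit_interval R) :=
  if p.1.1 == p.1.2 then p.1.1 else (s p.1 : unit_interval R -> X) p.2.
have clD : closed (@diagonal X) := diagonal_closed hX.
have fF z t : F z -> f (z, t) = (s z : unit_interval R -> X) t.
  rewrite /f /=; case: eqP => // + Fz; case: z Fz => x y /= Fxy eqxy.
  by move: Fxy; rewrite -eqxy => /FU/refl_s ->.
apply: (reserved_section_extension (f := f)).
- exact: closedU.
- exact: subsetUr.
- rewrite (_ : _ `*` _ = F `*` setT `|` @diagonal X `*` setT); last first.
    apply/seteqP; split=> [p [[] ? _]|p [[]|[]]]; [left|right| |] => //.
      by split=> //; left.
    by split=> //; right.
  apply: withinU_continuous; [exact: closed_setXT|exact: closed_setXT| |].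
    pose sf (p : (X * X) * unit_interval R) :=
      (s p.1 : unit_interval R -> X) p.2.
    apply: (subspace_eq_continuous (f := sf)).
      by move=> [z t] /set_mem[/= Fz _]; rewrite /from_subspace fF.
    by apply: path_space_uncurry; exact: continuous_subspaceW cs.
  pose x_of (p : (X * X) * unit_interval R) := p.1.1.
  apply: (subspace_eq_continuous (f := x_of)).
    by move=> [z t] /set_mem[/= + _]; rewrite /from_subspace /f /= => /eqP ->.
  apply: continuous_subspaceT => p.
  by apply: continuous_comp; exact: cvg_fst.
- move=> z [Fz|]; last by case: z => x y /diagonalP<-; rewrite /f /= eqxx.
  by rewrite !fF//; have := ends_s z (FU z Fz); case: z {Fz} => x y [-> ->].
- by move=> x t; rewrite /f /= eqxx.
Qed.
End reserved_sections.

(** * The category of the quotient *)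

Lemma minimal_number_le (R : realType) (P P' : nat -> Prop) :
  (forall k, (0 < k)%N -> P k -> P' k) ->
  (minimal_number R P' <= minimal_number R P)%E.
Proof.
move=> PP'; apply: le_ereal_inf => _ [k [k0 Pk] <-]; exists k => //.
by split=> //; exact: PP'.
Qed.

Section collapse_contraction.
Context {R : realType} {X : topologicalType}.
Local Open Scope quotient_scope.
Notation Q := (collapse (@diagonal X)).
Let q (z : X * X) : Q := \pi_Q z.

Let qE z w : (q z = q w) <-> (z = w \/ @diagonal X z /\ @diagonal X w).
Proof.
split=> [/eqmodP/predU1P[->|]|]; first by left.
  by move=> /andP[/set_mem ? /set_mem ?]; right.
move=> [-> //|[Dz Dw]]; apply/eqmodP/orP; right.
by rewrite !mem_set.
Qed.

Let cq : continuous q. Proof. exact: pi_continuous. Qed.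

(** The deformation [(x, y), t |-> (s (x, y) t, y)] respects the classes of the
    quotient.  To see that the induced map is continuous, it is viewed as a map
    from the quotient to the path space of the quotient: continuity of such a
    map can be tested upstairs, and joint continuity follows because [0, 1] is
    locally compact. *)
Lemma contractible_collapse (U : set (X * X)) (s : X * X -> path_space R X) :
  open U -> @diagonal X `<=` U -> reserved_section U s ->
  open (q @` U) /\ contractible_in R (q @` U).
Proof.
move=> oU DU [cs ends_s refl_s].
have satU z : (q @` U) (q z) -> U z.
  by move=> [w Uw /qE[<-//|[_ /DU]]].
have preU : q @^-1` (q @` U) = U.
  by apply/seteqP; split=> [z /satU//|z Uz]; exists z.
have oqU : open (q @` U) by rewrite -[open _]/(open (q @^-1` (q @` U))) preU.
split=> //.
pose H (p : (X * X) * unit_interval R) : Q :=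
  q ((s p.1 : unit_interval R -> X) p.2, p.1.2).
have cH : {within U `*` setT, continuous H}.
  have /subspace_continuousP cs' := path_space_uncurry cs.
  apply/subspace_continuousP => -[z t] Uzt.
  have cy : p.1.2 @[p --> within (U `*` setT) (nbhs (z, t))] --> z.2.
    apply: cvg_within_filter.
    by apply: cvg_comp; [exact: cvg_fst|exact: cvg_snd].
  pose g (p : (X * X) * unit_interval R) :=
    ((s p.1 : unit_interval R -> X) p.2, p.1.2).
  have cg : g @ within (U `*` setT) (nbhs (z, t)) --> g (z, t).
    exact: cvg_pair (cs' (z, t) Uzt) cy.
  by apply: (cvg_comp g q cg); exact: cq.
have [k [ck kE]] := path_space_curry q cH.
have H_diag z t : @diagonal X z -> H (z, t) = q z.
  case: z => x y /diagonalP <-.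
  by rewrite /H /= refl_s//; exact: DU.
have kq z : U z -> k (repr (q z)) = k z.
  move=> Uz; have : q (repr (q z)) = q z by rewrite /q reprK.
  case/qE => [->//|[Dw Dz]]; apply/continuousEP => t.
  by rewrite !kE// ?H_diag//; [apply/qE; right|exact: DU].
have ckr : {within q @` U, continuous (k \o repr)}.
  rewrite continuous_open_subspace//; apply/(continuous_inP _ oqU) => W oW.
  rewrite -[open _]/(open (q @^-1` _)).
  rewrite (_ : _ @^-1` _ = U `&` k @^-1` W).
    move: W oW; apply/(continuous_inP _ oU).
    by rewrite -continuous_open_subspace.
  apply/seteqP; split=> z [] /=.
    by move=> /satU Uz; rewrite kq.
  by move=> Uz Wz; split; [exists z|rewrite /= kq].
exists (fun p => ((k (repr p.1)) : unit_interval R -> Q) p.2); split.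
- exact: path_space_uncurry ckr.
- move=> _ [z Uz <-] /=; rewrite kq// kE// /H /=.
  by have := ends_s z Uz; case: z {Uz} => x y [-> _].
- move=> _ _ [z Uz <-] [w Uw <-] /=; rewrite !kq// !kE// /H /=.
  have /(congr1 snd) /= <- := ends_s z Uz.
  have /(congr1 snd) /= <- := ends_s w Uw.
  by apply/qE; right.
Qed.

Lemma LS_cat_collapse_le_monoidal_TC : is_ENR R X -> compact [set: X] ->
  (LS_cat R Q <= monoidal_TC R X)%E.
Proof.
move=> ENR_X compact_X; apply: minimal_number_le => k _ [U [oU UT sU]].
have hX := ENR_hausdorff ENR_X.
have [F [clF FU FT]] := closed_shrinking (hausdorff_prod hX hX)
  (compact_square compact_X) oU UT.
have GP i : exists Gs : set (X * X) * (X * X -> path_space R X),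
    [/\ open Gs.1, F i `|` @diagonal X `<=` Gs.1 & reserved_section Gs.1 Gs.2].
  have [s sP] := sU i.
  have [G [s' ?]] :=
    reserved_section_diagonal ENR_X compact_X sP (clF i) (FU i).
  by exists (G, s').
have {GP}[G GP] := choice GP.
have qG i : open (q @` (G i).1) /\ contractible_in R (q @` (G i).1).
  have [oG FDG sG] := GP i; apply: contractible_collapse sG => //.
  by apply: subset_trans FDG; exact: subsetUr.
exists (fun i => q @` (G i).1).
split=> [i||i]; [exact: (qG i).1| |exact: (qG i).2].
rewrite -subTset => p _.
have [i _ Fip] : (\bigcup_i F i) (repr p) by rewrite FT.
have [_ FDG _] := GP i.
by exists i => //; exists (repr p); [apply: FDG; left|rewrite /q reprK].
Qed.
End collapse_contraction.

(** * Deformations to infinity *)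

Section clamp.
Context {R : realType}.

Lemma mem_clamp (x : R) : Num.max 0 (Num.min x 1) \in `[0 : R, 1]%classic.
Proof.
by rewrite inE /= in_itv /= le_max lexx /= ge_max ler01 ge_min lexx orbT.
Qed.

(** The projection of the line to [0, 1].  With it, a path run in three stages
    is given by a single formula instead of being glued from three pieces. *)
Definition clamp (x : R) : unit_interval R :=
  exist _ (Num.max 0 (Num.min x 1)) (mem_clamp x).

Lemma clamp_continuous : continuous clamp.
Proof.
apply: continuous_comp_initial => x.
have cmin : {for x, continuous (fun y : R => Num.min y 1 : R^o)}.
  by apply: (@continuous_min R R id (cst 1)); [exact: cvg_id|exact: cvg_cst].
by apply: (@continuous_max R R (cst 0) _ x _ cmin); exact: cvg_cst.
Qed.

Lemma clamp_le0 x : x <= 0 -> clamp x = zero.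
Proof.
move=> x0; apply: val_inj => /=.
by rewrite min_l ?max_l// (le_trans x0).
Qed.

Lemma clamp_ge1 x : 1 <= x -> clamp x = one.
Proof. by move=> x1; apply: val_inj => /=; rewrite min_r// max_r. Qed.

Lemma clamp_affine_continuous (a b : R) :
  continuous (fun t : unit_interval R => clamp (a * set_val t + b)).
Proof.
pose affine (t : unit_interval R) := a * set_val t + b.
move=> t; apply: (@continuous_comp _ _ _ affine clamp).
  have cv : {for t, continuous (set_val : unit_interval R -> R)}.
    exact: initial_continuous.
  have := cvgD (cvgM (cvg_cst a) cv) (cvg_cst b).
  by apply.
exact: clamp_continuous.
Qed.

End clamp.

Section segments.
Context {R : realType} {X : topologicalType} {n : nat}.

Definition segment (e : X -> 'rV[R]_n) (p : (X * X) * unit_interval R) :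
    'rV[R]_n :=
  (1 - set_val p.2) *: e p.1.1 + set_val p.2 *: e p.1.2.

Lemma segment_continuous e : continuous e -> continuous (segment e).
Proof.
move=> ce p; apply: cvg_rV => j; rewrite /segment.
under eq_fun do rewrite !mxE; rewrite !mxE.
have cv : (set_val q.2 : R) @[q --> p] --> (set_val p.2 : R).
  apply: (@continuous_comp _ _ _ snd set_val); first exact: cvg_snd.
  exact: initial_continuous.
have ce' (g : X * X -> X) : continuous g ->
    (e (g q.1) ord0 j) @[q --> p] --> e (g p.1) ord0 j.
  move=> cg.
  pose g1 (q : (X * X) * unit_interval R) := g q.1.
  apply: (@continuous_comp _ _ _ (e \o g1) (fun v : 'rV[R]_n => v ord0 j)).
    apply: (@continuous_comp _ _ _ g1).
      by apply: continuous_comp; [exact: cvg_fst|exact: cg].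
    exact: ce.
  exact: coord_continuous.
apply: cvgD; apply: cvgM => //.
- by apply: cvgB => //; exact: cvg_cst.
- by apply: (ce' fst) => q; exact: cvg_fst.
- by apply: (ce' snd) => q; exact: cvg_snd.
Qed.

End segments.

Section infinity.
Context {R : realType} {X : topologicalType}.
Hypotheses (ENR_X : is_ENR R X) (compact_X : compact [set: X]).
Notation Y := (set_type (~` @diagonal X)).

(** Over [V] the path at (x, y) follows the first coordinate of the deformation
    to a point (x', y') near the diagonal, then the retracted segment from x' to
    y', then the second coordinate backwards. *)
Lemma reserved_section_rel_infty (V : set Y) :
  closed V -> rel_infty_contractible R V ->
  exists (G : set (X * X)) (s : X * X -> path_space R X),
    [/\ open G, set_val @` V `|` @diagonal X `<=` G & reserved_section G s].
Proof.
move=> clV contrV.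
(* If [X] is empty, there is no default value for the retraction. *)
have [[x0 _]|noX] := pselect ([set: X] !=set0); last first.
  have noXX (z : X * X) : False by apply: noX; exists z.1.
  have [//|p|z|x|G [s [oG TG sG]]] := reserved_section_extension ENR_X
    compact_X (f := fun p => p.1.1) (@closedT (X * X)%type).
  - by case: (noXX p.1).
  - by case: (noXX z).
  - by case: (noXX (x, x)).
  by exists G, s; split=> //; exact: subset_trans TG.
have [n [U [e [r [oU ce cr Ue eK]]]]] := ENR_retract x0 ENR_X.
have hX := ENR_hausdorff ENR_X.
have hXX := hausdorff_prod hX hX.
have cXX := compact_square compact_X.
have clD := diagonal_closed hX.
pose W := [set z : X * X | forall t, U (segment e (z, t))].
have oW : open W.
  apply: (@open_tube _ _ (segment e @^-1` U)).
    exact: unit_interval_compact.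
  by apply: open_comp => // p _; exact: segment_continuous.
have segD x t : segment e ((x, x), t) = e x.
  by rewrite /segment /= -scalerDl subrK scale1r.
have DW : @diagonal X `<=` W by move=> [x y] /diagonalP <- t; rewrite segD.
have [|C [cC _ [h [ch h0 h1 hC]]]] := contrV [set y : Y | ~ W (set_val y)].
  apply: compact_set_type; rewrite (_ : _ @` _ = ~` W).
    by apply: subclosed_compact cXX _ => //; exact: open_closedC.
  apply/seteqP; split=> [_ [y /= ? <-]//|z nWz].
  have nDz : (~` @diagonal X) z by move/DW.
  by exists (exist _ z (mem_set nDz)).
pose A := set_val @` V `|` @diagonal X.
(* The deformation [h], made stationary on the diagonal. *)
pose H (p : (X * X) * unit_interval R) : X * X :=
  if insub p.1 is Some y then set_val (h ((y : Y), p.2)) else p.1.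
have HV y t : H (set_val y, t) = set_val (h (y, t)).
  by rewrite /H /= valK.
have HD z t : @diagonal X z -> H (z, t) = z.
  by move=> Dz; rewrite /H /= insubF// memNset//; apply.
have clA : closed A.
  have [B oB BV] : open (~` V) by exact: closed_openC.
  rewrite (_ : A = ~` B `|` @diagonal X).
    by apply: closedU => //; exact: open_closedC.
  apply/seteqP; split=> z [].
  - move=> [y Vy <-]; left=> By.
    by have : (~` V) y by rewrite -BV.
  - by right.
  - move=> nBz; have [Dz|nDz] := pselect (@diagonal X z); first by right.
    left; pose y : Y := exist _ z (mem_set nDz).
    exists y => //; apply: contrapT => nVy.
    by have : (set_val @^-1` B) y by rewrite BV.
  - by right.
have cH : {within A `*` setT, continuous H}.
  apply/subspace_continuousP => -[z t] [/= Az _] N; rewrite /from_subspace.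
  have [Dz|nDz] := pselect (@diagonal X z).
    rewrite HD// => zN.
    (* Outside the compact set [C], a neighbourhood of the diagonal, nothing
       moves. *)
    have clC : closed (set_val @` C).
      apply: compact_closed => //; apply: continuous_compact => //.
      by apply: continuous_subspaceT; exact: initial_continuous.
    exists (N `&` ~` (set_val @` C), setT) => /=.
      split; last exact: filterT.
      apply: filterI => //; apply: open_nbhs_nbhs.
      split; first exact: closed_openC.
      move=> [y _ yz]; have : (~` @diagonal X) (set_val y) by exact: set_valP.
      by rewrite yz.
    move=> [z' t'] [[/= Nz' nCz'] _] [/= Az' _].
    case: Az' Nz' nCz' => [[y' Vy' <-] Ny' nCy'|Dz' ? _]; last by rewrite HD.
    by rewrite HV hC// => Cy'; apply: nCy'; exists y'.
  case: Az nDz => // -[y Vy <-] _; rewrite HV => yN.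
  have /subspace_continuousP/(_ (y, t)) ch' := ch.
  have [] : within (V `*` setT) (nbhs (y, t)) (h @^-1` (set_val @^-1` N)).
    by apply: ch' => //; exact: initial_continuous.
  move=> [P Q] [/= /nbhs_set_typeP[P' P'y P'P] Qt] PQN.
  exists (P' `&` ~` @diagonal X, Q) => /=.
    split=> //; apply: filterI => //; apply: open_nbhs_nbhs.
    by split; [exact: closed_openC|exact: set_valP].
  move=> [z' t'] [[/= P'z' nDz'] Qt'] [/= [|//] + _].
  move=> [y' Vy' y'z']; rewrite -y'z' /preimage /= HV.
  apply: (PQN (y', t')) => //.
  by split=> //=; apply: P'P; rewrite /preimage /= y'z'.
have A_ind (P : X * X -> Prop) : (forall y, V y -> P (set_val y)) ->
    (forall x, P (x, x)) -> forall z, A z -> P z.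
  by move=> PV PD z [[y Vy <-]|]; [exact: PV|case: z => x y /diagonalP <-].
have H0 z : A z -> H (z, zero) = z.
  move: z; apply: (A_ind (fun z => H (z, zero) = z)) => [y Vy|x].
    by rewrite HV h0.
  by rewrite HD.
have H1 z : A z -> W (H (z, one)).
  move: z; apply: (A_ind (fun z => W (H (z, one)))) => [y Vy|x]; last first.
    by rewrite HD//; exact: DW.
  by rewrite HV; apply: contrapT; exact: h1.
pose a (t : unit_interval R) := clamp (3 * set_val t + 0).
pose b (t : unit_interval R) := clamp (3 * set_val t + (- 1)).
pose c (t : unit_interval R) := clamp ((- 3) * set_val t + 3).
(* During the first third only [a] moves, then only [b], then only [c]: the
   three stages are h forwards in the first coordinate, the segment, and h
   backwards in the second coordinate. *)
pose g (p : (X * X) * unit_interval R) : 'rV[R]_n :=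
  segment e (((H (p.1, a p.2)).1, (H (p.1, c p.2)).2), b p.2).
have seg0 u v : segment e ((u, v), zero) = e u.
  by rewrite /segment /= subr0 scale1r scale0r addr0.
have seg1 u v : segment e ((u, v), one) = e v.
  by rewrite /segment /= subrr scale1r scale0r add0r.
have gU z t : A z -> U (g (z, t)).
  move=> Az; rewrite /g /=.
  have [t1|t1] := leP (set_val t) (1 / 3).
    by rewrite /b clamp_le0 ?seg0//; lra.
  have [t2|t2] := leP (2 / 3) (set_val t).
    by rewrite /b clamp_ge1 ?seg1//; lra.
  rewrite /a /c !clamp_ge1; [|lra|lra].
  by rewrite -surjective_pairing; exact: H1.
have cg : {within A `*` setT, continuous g}.
  have /subspace_continuousP cH' := cH.
  apply/subspace_continuousP => -[z t] [/= Az _].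
  have cHk (k : unit_interval R -> unit_interval R) : continuous k ->
      H (p.1, k p.2) @[p --> within (A `*` setT) (nbhs (z, t))] --> H (z, k t).
    move=> ck N /(cH' (z, k t))[//|[P Q] [/= Pz Qkt] PQN].
    exists (P, k @^-1` Q); first by split=> //; exact: ck.
    by move=> [z' t'] [/= Pz' Qt'] [/= Az' _]; exact: (PQN (z', k t')).
  have cb : b p.2 @[p --> within (A `*` setT) (nbhs (z, t))] --> b t.
    apply: cvg_within_filter; apply: cvg_comp; first exact: cvg_snd.
    exact: clamp_affine_continuous.
  have c1 : (H (p.1, a p.2)).1 @[p --> within (A `*` setT) (nbhs (z, t))] -->
      (H (z, a t)).1.
    apply: cvg_comp; first by apply: cHk; exact: clamp_affine_continuous.
    exact: cvg_fst.
  have c2 : (H (p.1, c p.2)).2 @[p --> within (A `*` setT) (nbhs (z, t))] -->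
      (H (z, c t)).2.
    apply: cvg_comp; first by apply: cHk; exact: clamp_affine_continuous.
    exact: cvg_snd.
  pose g0 (p : (X * X) * unit_interval R) :=
    (((H (p.1, a p.2)).1, (H (p.1, c p.2)).2), b p.2).
  have cg0 : g0 @ within (A `*` setT) (nbhs (z, t)) --> g0 (z, t).
    exact: cvg_pair (cvg_pair c1 c2) cb.
  by apply: (cvg_comp g0 (segment e) cg0); exact: segment_continuous.
apply: (reserved_section_extension ENR_X compact_X (f := r \o g)).
- exact: clA.
- by move=> z Dz; right.
- apply: within_continuous_comp cg => v; rewrite inE => -[[z t] [/= Az _] <-].
  by apply: cr; exact: gU.
- move=> z Az; rewrite /= /g /=.
  have v0 : set_val (zero : unit_interval R) = 0 by [].
  have v1 : set_val (one : unit_interval R) = 1 by [].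
  have -> : a zero = zero by apply: clamp_le0; rewrite v0; lra.
  have -> : b zero = zero by apply: clamp_le0; rewrite v0; lra.
  have -> : b one = one by apply: clamp_ge1; rewrite v1; lra.
  have -> : c one = zero by apply: clamp_le0; rewrite v1; lra.
  by rewrite seg0 seg1 !eK !H0.
- by move=> x t; rewrite /= /g /= !HD//= segD eK.
Qed.

Lemma monoidal_TC_le_infty_cat : (monoidal_TC R X <= infty_cat R Y)%E.
Proof.
apply: minimal_number_le => k k0 [V [clV VT contrV]].
have GP i : exists Gs : set (X * X) * (X * X -> path_space R X),
    [/\ open Gs.1, set_val @` V i `|` @diagonal X `<=` Gs.1 &
        reserved_section Gs.1 Gs.2].
  have [G [s ?]] := reserved_section_rel_infty (clV i) (contrV i).
  by exists (G, s).
have {GP}[G GP] := choice GP.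
exists (fun i => (G i).1); split=> [i||i].
- by have [] := GP i.
- rewrite -subTset => z _; have [Dz|nDz] := pselect (@diagonal X z).
    (* A diagonal point lies in every [G i]; there is an index since k > 0. *)
    have [_ VG _] := GP (Ordinal k0).
    by exists (Ordinal k0) => //; apply: VG; right.
  have [i _ Viz] : (\bigcup_i V i) (exist _ z (mem_set nDz)) by rewrite VT.
  have [_ VG _] := GP i; exists i => //; apply: VG; left.
  by exists (exist _ z (mem_set nDz)).
- by have [_ _ ?] := GP i; exists (G i).2.
Qed.

End infinity.

Theorem theorem4p5 (R : realType) (X : topologicalType)
    (ENR_X : is_ENR R X) (compact_X : compact [set: X]) :
  (LS_cat R (collapse (@diagonal X)) <= monoidal_TC R X)%E /\
  (monoidal_TC R X <= infty_cat R (set_type (~` (@diagonal X))))%E.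
Proof.
split; first exact: LS_cat_collapse_le_monoidal_TC.
exact: monoidal_TC_le_infty_cat.
Qed.
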